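(* Let $r,n\ge1$ be integers, let $\alpha\in\mathbb F_{2^r}^\times$, and let $C_{1,\alpha}$ be the curve $y^2+y=\alpha(x^{2^r+1}+x^2)$ over $\mathbb F_{2^r}$. If $r$ is odd, then $$\#C_{1,\alpha}(\mathbb F_{2^{rn}})=\begin{cases}(2^{rn}+1)+2^{r(n+1)/2}&\text{if } n\equiv1,7\pmod 8,\\(2^{rn}+1)-2^{r(n+1)/2}&\text{if } n\equiv3,5\pmod 8,\\2^{rn}+1&\text{if } n\equiv2,6\pmod 8,\\(2^{rn}+1)+2^{r(n+2)/2}&\text{if } n\equiv4\pmod 8,\\(2^{rn}+1)-2^{r(n+2)/2}&\text{if } n\equiv0\pmod 8.\end{cases}$$ If $r$ is even, then $$\#C_{1,\alpha}(\mathbb F_{2^{rn}})=\begin{cases}(2^{rn}+1)+2^{r(n+1)/2}&\text{if } n\equiv1,3\pmod 4,\\2^{rn}+1&\text{if } n\equiv2\pmod 4,\\(2^{rn}+1)-2^{r(n+2)/2}&\text{if } n\equiv0\pmod 4.\end{cases}$$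
   Context: $\#C_{1,\alpha}(\mathbb F_{2^{rn}})$ is the number of affine solutions $(x,y)\in\mathbb F_{2^{rn}}^2$ of the equation plus one (for the single point at infinity). *)

(* Defs.v *)
From HB Require Import structures.
From mathcomp Require Import all_boot all_order all_algebra.
Set Implicit Arguments.
Unset Strict Implicit.
Unset Printing Implicit Defensive.
Import GRing.Theory.
Local Open Scope ring_scope.

(* The L-rational affine points of C_{1,alpha}, where alpha lies in K and
   iota exhibits the finite field L as an extension of K. *)
Definition C1_affine (K L : finFieldType) (iota : {rmorphism K -> L})
    (r : nat) (alpha : K) : {set L * L} :=
  [set p : L * L |
    p.2 ^+ 2 + p.2 == iota alpha * (p.1 ^+ (2 ^ r + 1) + p.1 ^+ 2)].

(* The extra 1 is the single point at infinity. *)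
Definition C1_card (K L : finFieldType) (iota : {rmorphism K -> L})
    (r : nat) (alpha : K) : nat :=
  (#|C1_affine iota r alpha| + 1)%N.

(* Main.v *)
Require Import Defs.
From HB Require Import structures.
From mathcomp Require Import all_boot all_order all_algebra.
From mathcomp Require Import all_fingroup all_solvable finfield.
From mathcomp Require Import zify ring.
Set Implicit Arguments.
Unset Strict Implicit.
Unset Printing Implicit Defensive.
Import GRing.Theory Num.Theory.
Local Open Scope ring_scope.

(** Write q = 2 ^ r, N = r * n, and let chi be the sign character
    x |-> (-1) ^ Tr(x) of L, where Tr is the trace from L to F_2.
    By Hilbert 90 the equation y ^ 2 + y = c has 1 + chi(c) solutions
    (card_artin_schreier).  Since alpha = b ^ 2 with b in F_q, scaling x by b
    removes alpha, so the affine count is 2 ^ N + S with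
      S = sum over x in L of chi(x ^ (q+1) + x ^ 2).
    The trace of x ^ (q+1) + x ^ 2 is a quadratic form on L over F_2.  Its polar
    form is Tr(x ^ q y + x y ^ q) = Tr(x ^ q (y + y ^ (q^2))), because the trace is
    invariant under Frobenius.  Hence S ^ 2 is 2 ^ N times the same sum taken
    over the radical L :&: F_(q^2) only (form_sum_sqr).  This gives S up to
    sign, and the three cases below differ in how the sign is found.

    - n odd.  The radical is F_q, where the form vanishes, so
      S = +- q ^ ((n+1)/2).  The same holds, with d for n, for the sum S_d of
      the same function over the subfield F_(q^d) when d divides n.  If
      d = p m with p prime, then a Galois group of order p acts on F_(q^d)
      with fixed field F_(q^m) and preserves the summand, so S_d = S_m
      modulo p (form_sum_frob_mod).  Comparing signs brings in
      q ^ ((p-1)/2) modulo p, that is the Legendre symbol (2/p) to the power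
      r, and by induction the sign of S is the Jacobi symbol (2/n) to the
      power r (form_sum_odd).
    - n = 2 modulo 4.  On the radical F_(q^2) the norm term has trace 0 in L, so
      the summand is chi, a nontrivial character there, and S = 0.
    - n divisible by 4.  Choose a in F_(q^4) with a ^ (q^2) + a = 1;
      translation by a absorbs the term x ^ 2 and gives
      S = chi(a ^ (q+1)) S' with S' = sum of chi(x ^ (q+1)).  Here S' is
      +- q ^ ((n+2)/2), and the nonempty fibres of x |-> x ^ (q+1) over nonzero
      elements have q+1 elements, so S' = 1 modulo q+1, which forces the minus
      sign.  Finally Tr(a ^ (q+1)) is r n / 4 modulo 2. *)

(** * The quadratic character of 2 *)

(** For odd n this is the condition that the Jacobi symbol (2/n) is -1. *)
Definition two_nonresidue (n : nat) : bool := ((n %% 8 == 3) || (n %% 8 == 5))%N.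

Lemma two_nonresidueM m n : odd m -> odd n ->
  two_nonresidue (m * n)%N = two_nonresidue m (+) two_nonresidue n.
Proof.
rewrite /two_nonresidue -modnMm => om on.
have : (m %% 8 < 8)%N by rewrite ltn_mod.
have : (n %% 8 < 8)%N by rewrite ltn_mod.
have : odd (m %% 8) by lia.
have : odd (n %% 8) by lia.
by move: (m %% 8)%N (n %% 8)%N; do 8?case=> //; do 8?case=> //.
Qed.

(** The sign that Gauss's argument produces is (-1) to the power
    1 + 2 + ... + (p-1)/2, which is a triangular number. *)
Lemma triangular_parity p : odd p ->
  odd 'C(p./2.+1, 2) = two_nonresidue p.
Proof.
move=> op; rewrite bin2 /two_nonresidue /=.
set k := (p %/ 8)%N.
have ep : p = (8 * k + p %% 8)%N by lia.
have : (p %% 8 < 8)%N by rewrite ltn_mod.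
have : odd (p %% 8) by lia.
case: (p %% 8)%N ep => [|[|[|[|[|[|[|[|//]]]]]]]] // -> _ _ /=.
- have -> : ((8 * k + 1)./2.+1 * (8 * k + 1)./2
             = ((4 * k + 1) * (2 * k)).*2)%N by nia.
  by rewrite doubleK; lia.
- have -> : ((8 * k + 3)./2.+1 * (8 * k + 3)./2
             = ((2 * k + 1) * (4 * k + 1)).*2)%N by nia.
  by rewrite doubleK oddM; lia.
- have -> : ((8 * k + 5)./2.+1 * (8 * k + 5)./2
             = ((4 * k + 3) * (2 * k + 1)).*2)%N by nia.
  by rewrite doubleK oddM; lia.
- have -> : ((8 * k + 7)./2.+1 * (8 * k + 7)./2
             = ((2 * k + 2) * (4 * k + 3)).*2)%N by nia.
  by rewrite doubleK oddM; lia.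
Qed.

(** Multiply out 2, 4, ..., p-1 in two ways.  Each of these numbers is,
    modulo p, j or -j for exactly one j at most (p-1)/2, with the sign
    (-1) ^ j: an even j occurs as itself and an odd j as p - j.  Hence
    2 ^ ((p-1)/2) h! is (-1) ^ (1 + ... + h) h! with h = (p-1)/2. *)
Lemma two_supplement (F : fieldType) p : p \in [pchar F] -> odd p ->
  2 ^+ p./2 = (-1) ^+ two_nonresidue p :> F.
Proof.
move=> chp op; set h := p./2.
have ep : p = (2 * h).+1 by rewrite /h; lia.
pose g j := if odd j then (p - j)%N else j.
pose s := iota 1 h.
have sP j : (j \in s) = (0 < j <= h)%N by rewrite mem_iota; lia.
have permg : perm_eq [seq g j | j <- s] [seq (2 * j)%N | j <- s].
  have ug : uniq [seq g j | j <- s].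
    rewrite map_inj_in_uniq ?iota_uniq // => i j; rewrite !sP /g.
    by case: ifP; case: ifP; lia.
  have sub : {subset [seq g j | j <- s] <= [seq (2 * j)%N | j <- s]}.
    move=> _ /mapP[j + ->]; rewrite sP => jh; apply/mapP.
    rewrite /g; case: ifP => oj.
      by exists ((p - j)./2); rewrite ?sP; lia.
    by exists (j./2); rewrite ?sP; lia.
  apply: uniq_perm => //.
    by rewrite map_inj_uniq ?iota_uniq // => i j; lia.
  by have [] := uniq_min_size ug sub; rewrite // !size_map.
have fact_neq0 : \prod_(j <- s) j%:R != 0 :> F.
  rewrite prodf_seq_neq0; apply/allP => j; rewrite sP => jh /=.
  by rewrite -(dvdn_pcharf chp) gtnNdvd; lia.
apply: (mulIf fact_neq0).
transitivity (\prod_(j <- s) (2 * j)%N%:R : F).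
  rewrite [RHS](eq_bigr (fun j => 2 * j%:R)); last by move=> j _; rewrite natrM.
  by rewrite big_split /= big_const_seq count_predT size_iota iter_mulr_1.
rewrite -(big_map (fun j => (2 * j)%N) xpredT (fun j => j%:R)) /=.
rewrite -(perm_big _ permg) big_map /=.
rewrite (eq_big_seq (fun j => (-1) ^+ j * j%:R)); last first.
  move=> j; rewrite sP => jh; rewrite /g -(signr_odd _ j).
  case: ifP => oj; last by rewrite mul1r.
  by rewrite natrB ?(pcharf0 chp) ?sub0r ?mulN1r //; lia.
rewrite big_split /=; congr (_ * _).
rewrite -triangular_parity // signr_odd -bin2_sum big_ltn // add0n.
by rewrite (big_morph _ (exprD _) (expr0 _)) /index_iota subn1.
Qed.

(** * Counting modulo p with a permutation of order p *)

Lemma card_fix_mod (T : finType) (p : nat) (A : {set T}) (s : T -> T) :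
    prime p -> {in A, forall x, s x \in A} -> {in A, forall x, iter p s x = x} ->
  #|A| = #|[set x in A | s x == x]| %[mod p].
Proof.
move=> pp sA sp.
(* s need not be injective outside A, so it is replaced by a permutation. *)
pose t x := if x \in A then s x else x.
have tA x : (t x \in A) = (x \in A) by rewrite /t; case: ifP => // /sA.
have iterA k x : x \in A -> iter k t x = iter k s x.
  move=> xA; elim: k => //= k IH; rewrite -IH /t ifT //.
  by elim: {IH} k => //= k; rewrite tA.
have tp x : iter p t x = x.
  have [xA|xA] := boolP (x \in A); first by rewrite iterA ?sp.
  by elim: (p) => //= k ->; rewrite /t (negPf xA).
have t_inj : injective t.
  move=> x y txy; rewrite -[x]tp -[y]tp.
  by case: p pp {sp tp} => // k _; rewrite !iterSr txy.
pose u := perm t_inj.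
have up : (u ^+ p = 1)%g.
  apply/permP => x; rewrite permX perm1 -{2}[x]tp.
  by apply: eq_iter => y; rewrite permE.
have pgr : (p.-group <[u]>)%g.
  rewrite /pgroup; apply: pnat_dvd (pnat_id pp).
  by rewrite -orderE order_dvdn up.
have uA : [acts <[u]>, on A | 'P]%g.
  rewrite cycle_subG; apply/astabsP => x.
  by rewrite /= /aperm permE tA.
rewrite (pgroup_fix_mod pgr uA); congr (_ %% _)%N; apply: eq_card => x.
rewrite in_setI afix_cycle ?in_setT // [RHS]inE; case xA: (x \in A) => //=.
by apply/afix1P/eqP; rewrite /= /aperm permE /t xA.
Qed.

(** The function b is constant on the orbits of s, which have size 1 or p; so
    only the fixed points survive in characteristic p. *)
Lemma sum_sign_fix_mod (F : fieldType) (T : finType) (p : nat) (A : {set T})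
    (s : T -> T) (b : T -> bool) :
    p \in [pchar F] -> {in A, forall x, s x \in A} ->
    {in A, forall x, iter p s x = x} -> {in A, forall x, b (s x) = b x} ->
  \sum_(x in A) (-1) ^+ b x = \sum_(x in A | s x == x) (-1) ^+ b x :> F.
Proof.
move=> chp sA sp sb.
have pp := pcharf_prime chp.
have cardb c : #|[set x in A | b x == c]|%:R
             = #|[set x in A | (b x == c) && (s x == x)]|%:R :> F.
  rewrite -(GRing.natr_mod_pchar chp) (@card_fix_mod _ p _ s) //.
  - rewrite (GRing.natr_mod_pchar chp); congr _%:R; apply: eq_card => x.
    by rewrite !inE -andbA.
  - by move=> x; rewrite !inE => /andP[xA /eqP<-]; rewrite sA ?sb ?eqxx.
  - by move=> x; rewrite !inE => /andP[xA _]; rewrite sp.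
have split (P : pred T) : \sum_(x in A | P x) (-1) ^+ b x
     = #|[set x in A | (b x == false) && P x]|%:R
       - #|[set x in A | (b x == true) && P x]|%:R :> F.
  rewrite (bigID b) /= addrC; congr (_ + _).
    rewrite (eq_bigr (fun=> 1)) => [|x /andP[_ /negPf->]] //.
    rewrite sumr_const; congr (_ *+ _); apply: eq_card => x.
    by rewrite inE unfold_in eqbF_neg andbAC -andbA.
  rewrite (eq_bigr (fun=> -1)) => [|x /andP[_ ->]] //.
  rewrite sumr_const mulNrn; congr (- (_ *+ _)); apply: eq_card => x.
  by rewrite inE unfold_in eqb_id andbAC -andbA.
rewrite (split (fun x => s x == x)) -!cardb.
rewrite (eq_bigl (fun x => (x \in A) && xpredT x)) => [|x]; last by rewrite andbT.
rewrite (split xpredT); congr (_%:R - _%:R); apply: eq_card => x;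
  by rewrite !inE andbT.
Qed.

(** * Roots of unity in a finite field *)

Section Unity.
Variable L : finFieldType.

Lemma card_roots_le (p : {poly L}) (A : {set L}) :
  p != 0 -> {in A, forall x, root p x} -> (#|A| < size p)%N.
Proof.
move=> p0 rA; rewrite cardE; apply: max_poly_roots => //; last exact: enum_uniq.
by apply/allP => x; rewrite mem_enum => /rA.
Qed.

(** The polynomial X ^ m - 1 divides X ^ (#|L|-1) - 1, which has all nonzero
    elements as roots; since the cofactor has at most #|L|-1-m roots, at least
    m of them are roots of X ^ m - 1. *)
Lemma card_unity_roots m : (m %| #|L|.-1)%N -> #|[set x : L | x ^+ m == 1]| = m.
Proof.
case/dvdnP=> k ek.
have L1 : (1 < #|L|)%N := finNzRing_gt1 L.
have [m0 k0] : (0 < m)%N /\ (0 < k)%N by case: m k ek => [|m] [|k]; lia.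
pose g : {poly L} := \sum_(i < k) 'X^m ^+ i.
have fg : 'X^(k * m) - 1 = ('X^m - 1) * g :> {poly L}.
  by rewrite -subrX1 -exprM mulnC.
have km0 : (0 < k * m)%N by rewrite muln_gt0 k0.
have g0 : g != 0.
  apply/eqP => g0; have := fg; rewrite g0 mulr0 => /(congr1 (size \o polyseq)) /=.
  by rewrite size_XnsubC ?size_poly0.
have f0 : 'X^m - 1 != 0 :> {poly L} by rewrite -size_poly_gt0 size_XnsubC.
have sg : (size g = (k * m - m).+1)%N.
  have := congr1 (size \o polyseq) fg; rewrite /= size_mul // !size_XnsubC //.
  by have := leq_pmull m k0; move: (k * m)%N (size g) => a b; lia.
set A := [set x | _].
have leA : (#|A| <= m)%N.
  have := @card_roots_le ('X^m - 1) A f0; rewrite size_XnsubC // ltnS; apply=> x.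
  by rewrite inE rootE !hornerE subr_eq0.
pose B := [set x in [set~ 0] | x \notin A].
have leB : (#|B| <= k * m - m)%N.
  rewrite -ltnS -sg; apply: card_roots_le => // x; rewrite !inE => /andP[x0 xA].
  have : root (('X^m - 1) * g) x.
    rewrite -fg rootE !hornerE -ek subr_eq0; apply/eqP/(mulfI x0).
    by rewrite mulr1 -exprS prednK ?expf_card // ltnW.
  by rewrite rootM rootE !hornerE subr_eq0 (negPf xA).
have : (#|L|.-1 <= #|A| + #|B|)%N.
  rewrite -(cardsC1 (0 : L)) -(cardsID A [set~ 0]) leq_add //.
    by rewrite subset_leq_card // subsetIr.
  by apply: subset_leq_card; apply/subsetP => x; rewrite !inE andbC.
by rewrite ek; nia.
Qed.

End Unity.

(** * Subfields of a finite field of characteristic 2 *)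

Section Char2.
Variables (L : finFieldType) (N : nat).
Hypothesis cardL : #|L| = (2 ^ N)%N.
Implicit Types (x y z c : L) (e d k t : nat).

Let charL : 2%N \in [pchar L] := card_finPcharP cardL (erefl true).

Let degL_gt0 : (0 < N)%N.
Proof. by have := finNzRing_gt1 L; rewrite cardL; case: (N). Qed.

Lemma addrr_char2 x : x + x = 0. Proof. exact: addrr_pchar2. Qed.

Lemma eq_add0 x y : (x + y == 0) = (x == y).
Proof. by rewrite addr_eq0 oppr_pchar2. Qed.

Lemma frobD e x y : (x + y) ^+ (2 ^ e) = x ^+ (2 ^ e) + y ^+ (2 ^ e).
Proof. by rewrite exprDn_pchar // pnatX pnatE // charL. Qed.

Lemma frob_comp d e x : x ^+ (2 ^ d) ^+ (2 ^ e) = x ^+ (2 ^ (d + e)).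
Proof. by rewrite -exprM expnD. Qed.

Lemma frob_inj e : injective (fun x => x ^+ (2 ^ e)).
Proof.
move=> x y /eqP; rewrite -eq_add0 -frobD expf_eq0 => /andP[_].
by rewrite eq_add0 => /eqP.
Qed.

Lemma frob_full x : x ^+ (2 ^ N) = x.
Proof. by rewrite -cardL expf_card. Qed.

(** The subfield F_(2^e) of L when e divides N. *)
Definition fixed e : {set L} := [set x | x ^+ (2 ^ e) == x].

Lemma fixedP e x : reflect (x ^+ (2 ^ e) = x) (x \in fixed e).
Proof. by rewrite inE; apply: eqP. Qed.

Lemma fixedD e x y : x \in fixed e -> y \in fixed e -> x + y \in fixed e.
Proof. by move=> /fixedP xe /fixedP ye; apply/fixedP; rewrite frobD xe ye. Qed.

Lemma fixedDr e x y : y \in fixed e -> (x + y \in fixed e) = (x \in fixed e).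
Proof.
move=> ye; apply/idP/idP => [xy|xe]; last exact: fixedD.
by rewrite -[x]addr0 -(addrr_char2 y) addrA fixedD.
Qed.

Lemma fixedM e x y : x \in fixed e -> y \in fixed e -> x * y \in fixed e.
Proof. by move=> /fixedP xe /fixedP ye; apply/fixedP; rewrite exprMn xe ye. Qed.

Lemma fixedX e i x : x \in fixed e -> x ^+ i \in fixed e.
Proof. by move=> /fixedP xe; apply/fixedP; rewrite exprAC xe. Qed.

Lemma fixedV e x : x \in fixed e -> x^-1 \in fixed e.
Proof. by move=> /fixedP xe; apply/fixedP; rewrite exprVn xe. Qed.

Lemma fixed_frob e d x : (x ^+ (2 ^ d) \in fixed e) = (x \in fixed e).
Proof.
apply/idP/idP => [/fixedP|/fixedX]; last exact.
by rewrite exprAC => /frob_inj/fixedP.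
Qed.

Lemma fixed_mul e k x : x \in fixed e -> x \in fixed (e * k).
Proof.
move=> xe; apply/fixedP; elim: k => [|k IH]; first by rewrite muln0.
by rewrite mulnS -frob_comp; move/fixedP: xe => ->.
Qed.

Lemma fixed_full : fixed N = [set: L].
Proof. by apply/setP => x; rewrite !inE frob_full eqxx. Qed.

(** Since gcd (d, 2) = 1, the degrees r d and 2 r have greatest common divisor
    r. *)
Lemma fixed_odd_double r d x : odd d ->
  x \in fixed (r * d) -> x \in fixed (2 * r) -> x \in fixed r.
Proof.
move=> od xd /(fixed_mul d./2)/fixedP x2; move/fixedP: xd.
have -> : (r * d = 2 * r * d./2 + r)%N by nia.
by rewrite -frob_comp x2 => /fixedP.
Qed.

Lemma card_fixed e : (e %| N)%N -> #|fixed e| = (2 ^ e)%N.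
Proof.
move=> eN; have e0 : (0 < e)%N by apply: dvdn_gt0 eN.
have e1 : (1 < 2 ^ e)%N by rewrite -{1}(expn0 2) ltn_exp2l.
have dv : ((2 ^ e).-1 %| #|L|.-1)%N.
  case/dvdnP: eN => k eN; rewrite cardL eN mulnC expnM; exact: dvdn_pred_predX.
have -> : fixed e = 0 |: [set x | x ^+ (2 ^ e).-1 == 1].
  apply/setP => x; rewrite !inE; case: (eqVneq x 0) => [->|x0] /=.
    by rewrite expr0n expn_eq0 eqxx.
  rewrite -{1}(prednK (ltnW e1)) exprS -{3}[x]mulr1.
  by rewrite (inj_eq (mulfI x0)).
rewrite cardsU1 card_unity_roots // inE expr0n (_ : (_ == 0)%N = false) /=.
  by rewrite eq_sym oner_eq0; lia.
by lia.
Qed.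

(** * The trace to the prime field *)

(** On the subfield F_(2^e) this is the trace to F_2. *)
Definition absTr e x : L := \sum_(i < e) x ^+ (2 ^ i).

Lemma absTrD e x y : absTr e (x + y) = absTr e x + absTr e y.
Proof. by rewrite /absTr -big_split; apply: eq_bigr => i _; rewrite frobD. Qed.

Lemma absTr0 e : absTr e 0 = 0.
Proof. by apply: (addIr (absTr e 0)); rewrite -absTrD !add0r. Qed.

Lemma absTrMn e x k : absTr e (x *+ k) = absTr e x *+ k.
Proof. by elim: k => [|k IH]; rewrite ?absTr0 // !mulrS absTrD IH. Qed.

(** Transitivity of the trace: the inner sum is the trace to F_(2^e). *)
Lemma absTr_tower e k x :
  absTr (e * k) x = absTr e (\sum_(j < k) x ^+ (2 ^ (e * j))).
Proof.
elim: k => [|k IH]; first by rewrite muln0 big_ord0 absTr0 /absTr big_ord0.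
rewrite mulnSr big_ord_recr /= absTrD -IH /absTr big_split_ord /=.
by congr (_ + _); apply: eq_bigr => i _; rewrite frob_comp.
Qed.

Lemma absTr_fixed e k x : x \in fixed e -> absTr (e * k) x = absTr e x *+ k.
Proof.
move=> xe; rewrite absTr_tower -absTrMn; congr absTr.
rewrite (eq_bigr (fun=> x)) => [|j _]; first by rewrite sumr_const card_ord.
by apply/fixedP/fixed_mul.
Qed.

(** The sum telescopes; with e = N, this is the easy half of Hilbert 90. *)
Lemma absTr_artin_schreier e y : absTr e (y ^+ 2 + y) = y ^+ (2 ^ e) + y.
Proof.
elim: e => [|e IH]; first by rewrite /absTr big_ord0 expr1 addrr_char2.
rewrite /absTr big_ord_recr /= -/(absTr e _) {}IH frobD -exprM -expnS.
by rewrite addrACA [_ + y ^+ (2 ^ e)]addrC addrACA addrr_char2 add0r.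
Qed.

Lemma absTr_sqr e x : absTr e x ^+ 2 = absTr e (x ^+ 2).
Proof.
rewrite /absTr (big_morph (fun z : L => z ^+ 2) (frobD 1) (expr0n L 2)).
by apply: eq_bigr => i _; rewrite exprAC.
Qed.

Lemma absTr_bool e x : x \in fixed e -> (absTr e x == 0) || (absTr e x == 1).
Proof.
move/fixedP => xe; have /eqP := absTr_artin_schreier e x.
rewrite absTrD -absTr_sqr xe addrr_char2 eq_add0 -subr_eq0.
by rewrite -{2}[absTr e x]mulr1 expr2 -mulrBr mulf_eq0 subr_eq0.
Qed.

(** The trace is a polynomial function of degree 2 ^ (e-1). *)
Lemma card_absTr_ker e : (0 < e)%N ->
  (#|[set x : L | (absTr e x == 0)%R]| <= 2 ^ e.-1)%N.
Proof.
case: e => // e _.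
pose p : {poly L} := \sum_(i < e.+1) 'X^(2 ^ i).
have sp : (size p <= (2 ^ e).+1)%N.
  apply: leq_trans (size_sum _ _ _) _; apply/bigmax_leqP => i _.
  by rewrite size_polyXn ltnS leq_pexp2l // -ltnS.
have p0 : p != 0.
  apply/eqP => /(congr1 (fun q : {poly L} => q`_1%N)) /eqP.
  rewrite /= coef0 coef_sum big_ord_recl coefXn eqxx big1 ?addr0 ?oner_eq0 // => i _.
  rewrite coefXn /= /bump add1n expnS; case: eqP => // ; lia.
rewrite -ltnS; apply: leq_trans sp; apply: card_roots_le => // x.
rewrite inE rootE /absTr /p (big_morph _ (fun p q => hornerD p q x) (horner0 x)).
by move=> /eqP H; apply/eqP; rewrite -[RHS]H; apply: eq_bigr => i _; rewrite hornerXn.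
Qed.

(** * The sign character of the additive group *)

Definition chi x : int := (-1) ^+ (absTr N x != 0).

Lemma absTrL_bool x : (absTr N x == 0) || (absTr N x == 1).
Proof. by apply: absTr_bool; rewrite fixed_full inE. Qed.

Lemma chiD x y : chi (x + y) = chi x * chi y.
Proof.
rewrite /chi absTrD; have := absTrL_bool x; have := absTrL_bool y.
case/orP=> /eqP-> /orP[] /eqP->; rewrite ?addr0 ?add0r ?addrr_char2 ?eqxx ?oner_eq0 //=.
Qed.

Lemma chi0 : chi 0 = 1. Proof. by rewrite /chi absTr0 eqxx. Qed.

Lemma chi_sqr1 x : chi x * chi x = 1.
Proof. by rewrite -chiD addrr_char2 chi0. Qed.

Lemma chi_sqr x : chi (x ^+ 2) = chi x.
Proof.
rewrite /chi; congr ((-1) ^+ _); congr (~~ _); apply/eqP/eqP.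
  by rewrite -absTr_sqr => /eqP; rewrite sqrf_eq0 => /eqP.
by rewrite -absTr_sqr => ->; rewrite expr0n.
Qed.

Lemma chi_frob e x : chi (x ^+ (2 ^ e)) = chi x.
Proof. by elim: e => // e IH; rewrite expnSr exprM chi_sqr. Qed.

(** A fibre of y |-> y ^ 2 + y has at most 2 elements, and is empty unless the
    trace of c vanishes.  As the trace has at most 2 ^ (N-1) zeros, these bounds
    add up to at most 2 ^ N, the number of all y; so each of them is attained. *)
Lemma card_artin_schreier c :
  (#|[set y : L | y ^+ 2 + y == c]|)%:Z = 1 + chi c.
Proof.
pose F c := #|[set y : L | y ^+ 2 + y == c]|.
pose G c := if absTr N c == 0 then 2%N else 0%N.
have leFG x : (F x <= G x)%N.
  rewrite /F /G; case: (set_0Vmem [set y : L | y ^+ 2 + y == x]) => [->|[y]].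
    by rewrite cards0.
  rewrite inE => /eqP yx; have -> : absTr N x == 0.
    by rewrite -yx absTr_artin_schreier frob_full addrr_char2.
  apply: leq_trans (_ : #|[set y; (- (y + 1))%R]| <= 2)%N; last first.
    by rewrite cards2; case: eqP.
  apply/subset_leq_card/subsetP => z; rewrite !inE -yx -subr_eq0 => H.
  by rewrite -[z == y]subr_eq0 -addr_eq0 -mulf_eq0 -(eqP H); apply/eqP; ring.
have sumF : \sum_c F c = #|L|.
  rewrite -cardsT -sum1_card [RHS](partition_big (fun y => y ^+ 2 + y) xpredT) //=.
  apply: eq_bigr => x _; rewrite /F -sum1_card; apply: eq_bigl => y.
  by rewrite !inE.
have sumG : (\sum_c G c <= #|L|)%N.
  rewrite /G -big_mkcond /= sum_nat_const cardL -{2}(prednK degL_gt0) expnSr.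
  rewrite leq_mul2r /=; apply: leq_trans (card_absTr_ker degL_gt0).
  by apply: subset_leq_card; apply/subsetP => x; rewrite inE.
have [le_sum] := leqif_sum (fun x (_ : true) => leqif_eq (leFG x)).
have -> : (\sum_c F c == \sum_c G c)%N by rewrite eqn_leq le_sum sumF sumG.
move=> /esym/forallP/(_ c) /= /eqP eFG.
by rewrite -/(F c) eFG /G /chi; case: eqP.
Qed.

(** For x in the subfield, the trace from L is N/e times the trace from the
    subfield, hence equal to it; and the latter has fewer than 2 ^ e zeros. *)
Lemma chi_nontrivial e : (e %| N)%N -> odd (N %/ e) ->
  exists2 x, x \in fixed e & chi x = -1.
Proof.
move=> eN oN; have e0 : (0 < e)%N by apply: dvdn_gt0 eN.
have : ~~ (fixed e \subset [set x | absTr e x == 0]).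
  apply/negP => /subset_leq_card; rewrite card_fixed // => H.
  have := leq_trans H (card_absTr_ker e0); rewrite leqNgt ltn_exp2l //; lia.
case/subsetPn => x xe; rewrite inE => tx; exists x => //.
rewrite /chi -(divnK eN) mulnC absTr_fixed // -[(N %/ e)%N]odd_double_half oN.
rewrite -mul2n mulrnDr mulrnA mulr2n addrr_char2 mul0rn addr0 mulr1n.
by rewrite tx.
Qed.

(** Orthogonality of characters on a subfield. *)
Lemma sum_chi_mul e c : (e %| N)%N -> odd (N %/ e) -> c \in fixed e ->
  \sum_(x in fixed e) chi (x * c) = if c == 0 then (2 ^ e)%N%:Z else 0.
Proof.
move=> eN oN ce; case: eqP => [->|/eqP c0].
  rewrite (eq_bigr (fun=> 1)) => [|x _]; last by rewrite mulr0 chi0.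
  by rewrite sumr_const card_fixed // -natz.
have [z ze chiz] := chi_nontrivial eN oN.
(* Translating x by z / c changes the sign of every term. *)
set S := \sum_(_ in _) _; suff : S = - S by lia.
rewrite {1}/S (reindex_inj (addIr (z / c))) /= -mulN1r mulr_sumr.
have zc : z / c \in fixed e by rewrite fixedM ?fixedV.
apply: eq_big => [x|x _]; first by rewrite fixedDr.
by rewrite mulrDl divfK // chiD chiz mulrC.
Qed.

(** * Character sums of quadratic forms *)

(** The two values t = 1 and t = 0 give the form of the curve and the pure norm
    form; they have the same polar form, so both are treated together. *)
Definition form r t x : L := x ^+ (2 ^ r).+1 + x ^+ 2 *+ t.

Definition form_sum r t e : int := \sum_(x in fixed e) chi (form r t x).

Lemma formD r t x y :
  form r t (x + y)
  = form r t x + form r t y + (x ^+ (2 ^ r) * y + x * y ^+ (2 ^ r)).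
Proof.
have sqD : (x + y) ^+ 2 = x ^+ 2 + y ^+ 2 := frobD 1 x y.
rewrite /form sqD mulrnDl !(exprS _ (2 ^ r)) frobD.
by move: (x ^+ (2 ^ r)) (y ^+ (2 ^ r)) (x ^+ _ *+ t) (y ^+ _ *+ t) => X Y A B; ring.
Qed.

(** chi is invariant under Frobenius, so the polar term x y ^ q may be replaced
    by its q-th power x ^ q y ^ (q^2), which isolates a common factor x ^ q. *)
Lemma chi_formD r t x y :
  chi (form r t x) * chi (form r t (x + y))
  = chi (form r t y) * chi (x ^+ (2 ^ r) * (y + y ^+ (2 ^ (2 * r)))).
Proof.
rewrite formD (chiD (_ r t x + _)) (chiD (form r t x)) (chiD (_ * y)).
rewrite !mulrA chi_sqr1 mul1r -mulrA mulrDr (chiD (_ * y)).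
by rewrite -(chi_frob r (x * _)) exprMn frob_comp addnn mul2n.
Qed.

(** Expand the square as a double sum over x and x + y; by chi_formD the sum over
    x is a complete character sum, which vanishes unless y is in the radical. *)
Lemma form_sum_sqr r t e : (e %| N)%N -> odd (N %/ e) ->
  form_sum r t e ^+ 2
  = 2 ^+ e * \sum_(y in fixed e | y \in fixed (2 * r)) chi (form r t y).
Proof.
move=> eN oN; rewrite expr2 /form_sum big_distrlr /=.
under eq_bigr => x xe.
  rewrite (reindex_inj (addrI x)) /=.
  under eq_bigl => y do rewrite addrC fixedDr //.
  under eq_bigr => y _ do rewrite chi_formD.
  over.
rewrite exchange_big /= mulr_sumr [RHS]big_mkcondr /=; apply: eq_bigr => y ye.
rewrite -mulr_sumr; set c := y + _.
have ce : c \in fixed e by rewrite fixedD ?fixed_frob.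
transitivity (chi (form r t y) * \sum_(x in fixed e) chi (x * c)).
  congr (_ * _); rewrite [RHS](reindex_inj (@frob_inj r)) /=.
  by apply: eq_bigl => x; rewrite fixed_frob.
rewrite sum_chi_mul // /c eq_add0 inE eq_sym; case: eqP => _; last by rewrite mulr0.
by rewrite mulrC -natz natrX.
Qed.

(** On F_q the two terms of the form cancel, as x ^ (q+1) = x ^ 2. *)
Lemma form_sum_fixed r : form_sum r 1 r = #|fixed r|%:Z.
Proof.
rewrite /form_sum (eq_bigr (fun=> 1)) ?sumr_const -?natz // => x /fixedP xr.
by rewrite /form exprS xr addrr_char2 chi0.
Qed.

(** * The sign in odd degree *)

Lemma form_sum_sqr_odd r d : odd d -> (r * d %| N)%N -> odd (N %/ (r * d)) ->
  form_sum r 1 (r * d) ^+ 2 = (2 ^+ (r * d.+1./2)) ^+ 2.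
Proof.
move=> od dN oN; rewrite form_sum_sqr //.
rewrite (eq_bigl [in fixed r]) => [|y]; last first.
  apply/andP/idP => [[]|yr]; first exact: fixed_odd_double.
  by split; [|rewrite mulnC]; apply: fixed_mul.
have := form_sum_fixed r; rewrite /form_sum => ->.
rewrite card_fixed; last by apply: dvdn_trans dN; rewrite dvdn_mulr.
by rewrite -natz natrX -exprD -exprM -mulnSr -mulnA muln2 even_halfK //= od.
Qed.

(** The map x |-> x ^ (q ^ m) has order dividing p on F_(q^(p m)), its fixed
    points there form F_(q^m), and it leaves chi (form x) unchanged. *)
Lemma form_sum_frob_mod (F : fieldType) p r m : p \in [pchar F] ->
  (form_sum r 1 (r * (p * m)))%:~R = (form_sum r 1 (r * m))%:~R :> F.
Proof.
move=> chp; pose b x := absTr N (form r 1 x) != 0.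
have intr_chi x : (chi (form r 1 x))%:~R = (-1) ^+ b x :> F.
  by rewrite /chi rmorphXn rmorphN1.
rewrite /form_sum !rmorph_sum.
rewrite (eq_bigr _ (fun x _ => intr_chi x)) [RHS](eq_bigr _ (fun x _ => intr_chi x)).
rewrite (sum_sign_fix_mod (s := fun x => x ^+ (2 ^ (r * m))) chp).
- apply: eq_bigl => x; rewrite [RHS]inE.
  case: (_ =P x) => [/fixedP xm|]; last by rewrite andbF.
  by rewrite andbT mulnCA mulnC fixed_mul.
- by move=> x; rewrite fixed_frob.
- move=> x /fixedP {2}<-; rewrite mulnCA.
  elim: (p) => [|k IH]; first by rewrite expr1.
  by rewrite iterS IH frob_comp mulSnr.
- move=> x _; have fb : chi (form r 1 (x ^+ (2 ^ (r * m)))) = chi (form r 1 x).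
    rewrite -[RHS](chi_frob (r * m)) /form !mulr1n frobD.
    by congr (chi (_ + _)); apply: exprAC.
  by move: fb; rewrite /chi /b; case: eqP; case: eqP.
Qed.

(** Induction on d, splitting off a prime factor p.  Both sums are known up to
    sign and agree modulo p; as p is odd, the signs can be compared in F_p. *)
Lemma form_sum_odd r n d : N = (r * n)%N -> odd n -> (d %| n)%N ->
  form_sum r 1 (r * d)
  = (-1) ^+ (odd r && two_nonresidue d) * 2 ^+ (r * d.+1./2).
Proof.
move=> eN on; have r0 : (0 < r)%N by move: degL_gt0; rewrite eN muln_gt0 => /andP[].
have [k] := ubnP d; elim: k d => // k IH d ledk dn.
have od : odd d := dvdn_odd dn on.
have [d1|d1] := leqP d 1.
  have -> : d = 1%N by case: d d1 od {dn ledk} => [|[]].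
  rewrite andbF mul1r !muln1 form_sum_fixed card_fixed ?eN ?dvdn_mulr //.
  by rewrite -natz natrX.
pose p := pdiv d; have pp : prime p := pdiv_prime d1.
have ed : d = (p * (d %/ p))%N by rewrite mulnC divnK ?pdiv_dvd.
move: (d %/ p)%N ed => m ed; clearbody p.
have p1 := prime_gt1 pp.
have [op om] : odd p /\ odd m by move: od; rewrite ed oddM => /andP[].
have chp := pchar_Fp pp.
have mn : (m %| n)%N by apply: dvdn_trans dn; rewrite ed dvdn_mull.
have {}IH := IH m _ mn.
have H := @form_sum_frob_mod 'F_p p r m chp.
rewrite -ed IH in H; last first.
  by move: ledk; rewrite ltnS; apply: leq_trans; rewrite ed ltn_Pmull // odd_gt0.
have on' : odd (n %/ d) by move: on; rewrite -{1}(divnK dn) oddM => /andP[].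
have /eqP : form_sum r 1 (r * d) ^+ 2 = (2 ^+ (r * d.+1./2)) ^+ 2.
  by apply: form_sum_sqr_odd; rewrite // eN ?dvdn_pmul2l ?divnMl.
rewrite eqf_sqr => sgn.
have [c ec] : exists c : bool, form_sum r 1 (r * d) = (-1) ^+ c * 2 ^+ (r * d.+1./2).
  case/orP: sgn => /eqP ->; first by exists false; rewrite mul1r.
  by exists true; rewrite mulN1r.
rewrite {sgn}ec in H *; congr ((-1) ^+ (nat_of_bool _) * _).
have e2 : (r * d.+1./2 = p./2 * (r * m) + r * m.+1./2)%N.
  have -> : (d.+1./2 = p./2 * m + m.+1./2)%N.
    have -> : d = ((p./2 * m).*2 + m)%N.
      by rewrite {1}ed -{1}(odd_double_half p) op mulnDl mul1n -doubleMl addnC.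
    by lia.
  by rewrite mulnDr mulnCA.
have two0 : 2 != 0 :> 'F_p.
  by rewrite -(dvdn_pcharf chp); apply/negP => /dvdn_leq; lia.
move: H; rewrite !rmorphM !rmorphXn !rmorphN1 /= e2 exprD mulrA.
move/(mulIf (expf_neq0 _ two0)).
have sgn_inj (u v : bool) : (-1) ^+ u = (-1) ^+ v :> 'F_p -> u = v.
  have neq : 1 <> -1 :> 'F_p.
    by move/eqP; rewrite -subr_eq0 opprK (negPf two0).
  by case: u v => [] []; rewrite ?expr0 ?expr1 // => h; case: neq.
rewrite exprM (two_supplement chp op) -exprM -(signr_odd _ (_ * _)).
rewrite -signr_addb ed two_nonresidueM // !oddM om andbT oddb => /sgn_inj.
by case: c (odd r) (two_nonresidue p) (two_nonresidue m) => [] [] [] [].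
Qed.

(** * Even degree *)

(** For y in F_(q^2) the norm y ^ (q+1) lies in F_q, and the trace from L of an
    element of F_q is n times its trace from F_q, hence 0. *)
Lemma chi_norm r n y : N = (r * n)%N -> ~~ odd n ->
  y \in fixed (2 * r) -> chi (y ^+ (2 ^ r).+1) = 1.
Proof.
move=> eN en /fixedP y2; rewrite /chi eN absTr_fixed; last first.
  apply/fixedP; rewrite exprAC exprS frob_comp.
  by rewrite addnn -mul2n y2 -exprSr.
by rewrite -(even_halfK en) -mul2n mulrnA mulr2n addrr_char2 mul0rn eqxx.
Qed.

(** The radical is F_(q^2), where by chi_norm the summand at y is chi y.  As L has
    odd degree n/2 over it, chi is nontrivial there. *)
Lemma form_sum_2mod4 r n : N = (r * n)%N -> (n %% 4 = 2)%N -> form_sum r 1 N = 0.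
Proof.
move=> eN n4; have r0 : (0 < r)%N by move: degL_gt0; rewrite eN muln_gt0 => /andP[].
have en : n = (2 * (n %/ 2))%N by lia.
have e2 : N = (2 * r * (n %/ 2))%N by rewrite eN {1}en mulnCA mulnA.
apply/eqP; rewrite -sqrf_eq0 form_sum_sqr ?divnn ?degL_gt0 // mulf_eq0 orbC.
rewrite fixed_full (eq_bigl [in fixed (2 * r)]) => [|y]; last by rewrite inE.
rewrite (eq_bigr (fun y => chi (y * 1))) => [|y y2]; last first.
  by rewrite chiD chi_sqr (chi_norm eN) ?mul1r ?mulr1 //; lia.
rewrite sum_chi_mul ?oner_eq0 ?eqxx //.
- by rewrite e2 dvdn_mulr.
- by rewrite e2 mulKn ?muln_gt0 //; lia.
- by apply/fixedP; rewrite expr1n.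
Qed.

(** A nonempty fibre is a coset of the group of (q+1)-th roots of unity. *)
Lemma card_norm_fiber r c : (2 * r %| N)%N ->
  c != 0 -> ((2 ^ r).+1 %| #|[set x : L | x ^+ (2 ^ r).+1 == c]|)%N.
Proof.
move=> rN c0; case: (set_0Vmem [set x : L | x ^+ (2 ^ r).+1 == c]) => [->|[z]].
  by rewrite cards0.
rewrite inE => /eqP ez; have z0 : z != 0.
  by apply: contra_neq c0 => z0; rewrite -ez z0 expr0n.
rewrite -(card_imset _ (mulfI (invr_neq0 z0))).
rewrite (_ : _ @: _ = [set x | x ^+ (2 ^ r).+1 == 1]) ?card_unity_roots //.
  have : ((2 ^ r).+1 %| (2 ^ (2 * r)).-1)%N.
    by rewrite mulnC expnM -subn1 (subn_sqr _ 1) addn1 dvdn_mull.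
  move/dvdn_trans; apply; case/dvdnP: rN => k eN.
  by rewrite cardL eN (mulnC k) (expnM _ (2 * r)) dvdn_pred_predX.
apply/setP => x; apply/imsetP/idP => [[y + ->]|].
  by rewrite !inE exprMn exprVn ez => /eqP ->; rewrite mulVf.
rewrite inE => /eqP x1; exists (z * x); last by rewrite mulKf.
by rewrite inE exprMn x1 mulr1 ez.
Qed.

Lemma norm_form_sum_mod r : (2 * r %| N)%N ->
  (((2 ^ r).+1)%:Z %| form_sum r 0 N - 1)%Z.
Proof.
move=> rN; rewrite /form_sum fixed_full (bigD1 0) ?inE //=.
rewrite /form expr0n !mulr0n addr0 chi0 addrAC subrr add0r.
rewrite (partition_big (fun x => x ^+ (2 ^ r).+1) (predC1 0)) /=; last first.
  by move=> x /andP[_ x0]; rewrite expf_neq0.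
apply: rpred_sum => c c0.
rewrite (eq_bigr (fun=> chi c)) => [|x /andP[_ /eqP->]]; last by rewrite mulr0n addr0.
rewrite sumr_const -mulr_natr dvdz_mull // natz dvdzE /=.
have := card_norm_fiber rN c0; congr (_ %| _)%N; apply: eq_card => x.
rewrite inE unfold_in; case: (_ =P c) => [xc|_]; rewrite ?andbT ?andbF //.
by rewrite inE; apply/esym; apply: contra_neq c0 => x0; rewrite -xc x0 expr0n.
Qed.

(** The square is q ^ (n+2).  As (n+2)/2 is odd, q ^ ((n+2)/2) is -1 modulo q+1,
    and the sum is 1 modulo q+1; since q+1 does not divide 2, this fixes the
    sign. *)
Lemma norm_form_sum r n : N = (r * n)%N -> (n %% 4 = 0)%N ->
  form_sum r 0 N = - 2 ^+ (r * (n + 2)./2).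
Proof.
move=> eN n4.
have r0 : (0 < r)%N by move: degL_gt0; rewrite eN muln_gt0 => /andP[].
have en : n = (2 * (n %/ 2))%N by lia.
have e2 : N = (2 * r * (n %/ 2))%N by rewrite eN {1}en mulnCA mulnA.
have rN : (2 * r %| N)%N by rewrite e2 dvdn_mulr.
have /eqP : form_sum r 0 N ^+ 2 = (2 ^+ (r * (n + 2)./2)) ^+ 2.
  rewrite form_sum_sqr ?divnn ?degL_gt0 //.
  rewrite (eq_bigr (fun=> 1)) => [|y /andP[_ y2]]; last first.
    by rewrite /form mulr0n addr0 (chi_norm eN) //; lia.
  rewrite fixed_full (eq_bigl [in fixed (2 * r)]) => [|y]; last by rewrite inE.
  rewrite sumr_const card_fixed // natrX -exprM -exprD; congr (_ ^+ _).
  by rewrite -[RHS]mulnA muln2 even_halfK ?mulnDr ?[(2 * r)%N]mulnC ?eN //; lia.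
rewrite eqf_sqr => /orP[] /eqP // eS; exfalso.
have := norm_form_sum_mod rN; rewrite eS exprM.
have -> : ((n + 2)./2 = (n %/ 4).*2.+1)%N by lia.
set q : int := 2 ^+ r.
have eq1 : (2 ^ r).+1%:Z = q + 1 by rewrite -natz -natr1 natrX.
have d1 : (q + 1 %| q ^+ (n %/ 4).*2.+1 + 1)%Z.
  apply/dvdzP; exists (\sum_(i < (n %/ 4).*2.+1) (- q) ^+ i).
  have := subrX1 (- q) (n %/ 4).*2.+1; set T := \sum_(_ < _) _.
  rewrite exprNn -signr_odd /= odd_double /= expr1 mulN1r => h.
  by rewrite -[LHS]opprK opprD h; ring.
rewrite eq1 => d2; have := rpredB d1 d2.
rewrite opprB addrCA [_ + 1]addrC addrK -eq1 dvdzE => /dvdn_leq -/(_ erefl) /=.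
by rewrite ltnS leqNgt -{1}(expn0 2) ltn_exp2l // r0.
Qed.

(** Divide any x in F_(q^4) outside F_(q^2) by x ^ (q^2) + x, which is a nonzero
    element of F_(q^2). *)
Lemma exists_twist r : (4 * r %| N)%N ->
  exists2 a, a \in fixed (4 * r) & a ^+ (2 ^ (2 * r)) + a = 1.
Proof.
move=> rN; have r0 : (0 < r)%N by have := dvdn_gt0 degL_gt0 rN; rewrite muln_gt0.
have r2 : (2 * r %| N)%N by apply: dvdn_trans rN; rewrite dvdn_pmul2r.
have : ~~ (fixed (4 * r) \subset fixed (2 * r)).
  by apply/negP => /subset_leq_card; rewrite !card_fixed // leq_exp2l //; lia.
case/subsetPn => x x4 x2.
pose u := x ^+ (2 ^ (2 * r)) + x.
have u0 : u != 0 by rewrite eq_add0; apply: contra x2; rewrite inE.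
have u2 : u ^+ (2 ^ (2 * r)) = u.
  rewrite frobD frob_comp (_ : 2 * r + 2 * r = 4 * r)%N; last by lia.
  by move/fixedP: x4 => ->; rewrite addrC.
exists (x / u).
  by rewrite fixedM ?fixedV // fixedD ?fixed_frob.
by rewrite exprMn exprVn u2 -mulrDl mulfV.
Qed.

Lemma absTr1 e : absTr e 1 = e%:R.
Proof.
rewrite /absTr (eq_bigr (fun=> 1)) => [|i _]; last by rewrite expr1n.
by rewrite sumr_const card_ord.
Qed.

(** By chi_formD with y = a, translating by a turns the norm form into the form
    of the curve up to the constant chi (a ^ (q+1)).  The conjugates of
    a over F_q are a, b, a + 1, b + 1 with b = a ^ q, so the trace of a ^ (q+1)
    to F_q is a b + b (a + 1) + (a + 1)(b + 1) + (b + 1) a = 1. *)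
Lemma form_sum_0mod4 r n : N = (r * n)%N -> (n %% 4 = 0)%N ->
  form_sum r 1 N = - (-1) ^+ (odd r && odd (n %/ 4)) * 2 ^+ (r * (n + 2)./2).
Proof.
move=> eN n4.
have en : n = (4 * (n %/ 4))%N by lia.
have e4 : N = (r * 4 * (n %/ 4))%N by rewrite eN -mulnA -en.
have [|a a4 ha] := @exists_twist r; first by rewrite e4 mulnC dvdn_mulr // mulnC.
have chiQ x : chi (form r 1 x) = chi (form r 0 a) * chi (form r 0 (x + a)).
  have := chi_formD r 0 x a; rewrite [a + _]addrC ha mulr1 chi_frob.
  have -> : chi (form r 1 x) = chi (form r 0 x) * chi x.
    by rewrite /form chiD chi_sqr mulr0n addr0.
  have := chi_sqr1 x; have := chi_sqr1 (form r 0 (x + a)).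
  move: (chi x) (chi (form r 0 (x + a))) => X B BB XX h.
  by rewrite -[LHS]mulr1 -BB -[RHS]mulr1 -XX mulrACA h; ring.
have -> : form_sum r 1 N = chi (form r 0 a) * form_sum r 0 N.
  rewrite /form_sum mulr_sumr fixed_full [RHS](reindex_inj (addIr a)) /=.
  by apply: eq_big => x; rewrite ?inE.
rewrite (norm_form_sum eN n4) mulrN mulNr; congr (- (_ * _)).
rewrite /form mulr0n addr0 /chi {1}e4 absTr_fixed; last first.
  by rewrite fixedX // mulnC.
rewrite absTr_tower !big_ord_recr big_ord0 /= add0r muln0 expr1 muln1.
set z := a ^+ _.+1.
have -> : z + z ^+ (2 ^ r) + z ^+ (2 ^ (r * 2)) + z ^+ (2 ^ (r * 3)) = 1.
  have a2 : a ^+ (2 ^ (2 * r)) = a + 1.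
    by rewrite -ha addrCA addrr_char2 addr0.
  have a1 : a ^+ (2 ^ r) ^+ (2 ^ (2 * r)) = a ^+ (2 ^ r) + 1.
    by rewrite exprAC a2 frobD expr1n.
  have zE : z + z ^+ (2 ^ r) = a ^+ (2 ^ r).
    rewrite /z exprS exprMn frob_comp addnn -mul2n a2 mulrDr mulr1.
    by rewrite mulrC addrA addrr_char2 add0r.
  have -> : (r * 3 = r + 2 * r)%N by lia.
  rewrite -addrA [(r * 2)%N]mulnC -(frob_comp r (2 * r)) -frobD zE a1.
  by rewrite addrA addrr_char2 add0r.
by rewrite absTr1 -mulrnA -(dvdn_pcharf charL) dvdn2 negbK oddM.
Qed.

(** * Counting points *)

Lemma card_artin_schreier_curve (f : L -> L) :
  #|[set p : L * L | p.2 ^+ 2 + p.2 == f p.1]|%:Z = 2 ^+ N + \sum_x chi (f x).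
Proof.
transitivity (\sum_x (#|[set y | y ^+ 2 + y == f x]|)%:Z).
  rewrite -sum1_card big_mkcond /=.
  rewrite (eq_bigr (fun p => if p.2 ^+ 2 + p.2 == f p.1 then 1%N else 0%N));
    last by move=> p _; rewrite inE.
  rewrite -(pair_bigA _ (fun x y => if y ^+ 2 + y == f x then 1%N else 0%N)) /=.
  rewrite -natz natr_sum; apply: eq_bigr => x _; rewrite natz; congr Posz.
  by rewrite -big_mkcond /= -sum1_card; apply: eq_bigl => y; rewrite inE.
under eq_bigr => x _ do rewrite card_artin_schreier.
by rewrite big_split /= sumr_const cardL natrX.
Qed.

(** The substitution x |-> b x, with b the square root of a, removes a: since b is
    in F_q, b ^ (q+1) = b ^ 2 = a. *)
Lemma card_C1 r a : (r %| N)%N -> a \in fixed r -> a != 0 ->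
  #|[set p : L * L | p.2 ^+ 2 + p.2 == a * (p.1 ^+ (2 ^ r + 1) + p.1 ^+ 2)]|%:Z
  = 2 ^+ N + form_sum r 1 N.
Proof.
move=> rN ar a0; have r0 : (0 < r)%N := dvdn_gt0 degL_gt0 rN.
rewrite (card_artin_schreier_curve (fun x => a * (x ^+ (2 ^ r + 1) + x ^+ 2))).
congr (_ + _); pose b := a ^+ (2 ^ r.-1).
have eb : b ^+ 2 = a by rewrite -exprM -expnSr prednK //; apply/fixedP.
have br : b ^+ (2 ^ r) = b by apply/fixedP; rewrite fixedX.
have b0 : b != 0 by rewrite expf_neq0.
rewrite /form_sum fixed_full [RHS](reindex_inj (mulfI b0)) /=.
apply: eq_big => [x|x _]; first by rewrite inE.
by rewrite /form addn1 !exprMn (exprS b) br -expr2 eb mulr1n mulrDr.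
Qed.

End Char2.

Theorem theorem5 (r n : nat) (hr : (1 <= r)%N) (hn : (1 <= n)%N)
    (K L : finFieldType) (hK : #|K| = (2 ^ r)%N) (hL : #|L| = (2 ^ (r * n))%N)
    (iota : {rmorphism K -> L}) (alpha : K) (halpha : alpha != 0) :
  (odd r ->
    [/\ (n %% 8 = 1 \/ n %% 8 = 7)%N ->
          (C1_card iota r alpha)%:Z =
            (2 ^+ (r * n) + 1) + 2 ^+ (r * (n + 1) %/ 2),
        (n %% 8 = 3 \/ n %% 8 = 5)%N ->
          (C1_card iota r alpha)%:Z =
            (2 ^+ (r * n) + 1) - 2 ^+ (r * (n + 1) %/ 2),
        (n %% 8 = 2 \/ n %% 8 = 6)%N ->
          (C1_card iota r alpha)%:Z = 2 ^+ (r * n) + 1,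
        (n %% 8 = 4)%N ->
          (C1_card iota r alpha)%:Z =
            (2 ^+ (r * n) + 1) + 2 ^+ (r * (n + 2) %/ 2)
      & (n %% 8 = 0)%N ->
          (C1_card iota r alpha)%:Z =
            (2 ^+ (r * n) + 1) - 2 ^+ (r * (n + 2) %/ 2)]) /\
  (~~ odd r ->
    [/\ (n %% 4 = 1 \/ n %% 4 = 3)%N ->
          (C1_card iota r alpha)%:Z =
            (2 ^+ (r * n) + 1) + 2 ^+ (r * (n + 1) %/ 2),
        (n %% 4 = 2)%N ->
          (C1_card iota r alpha)%:Z = 2 ^+ (r * n) + 1
      & (n %% 4 = 0)%N ->
          (C1_card iota r alpha)%:Z =
            (2 ^+ (r * n) + 1) - 2 ^+ (r * (n + 2) %/ 2)]).
Proof.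
have ar : iota alpha \in fixed L r.
  by apply/fixedP; rewrite -rmorphXn -hK expf_card.
have a0 : iota alpha != 0 by rewrite fmorph_eq0.
have := card_C1 hL (dvdn_mulr n (dvdnn r)) ar a0.
rewrite /C1_card PoszD -/(C1_affine iota r alpha) => ->.
rewrite addrAC; set q1 := _ + 1%:Z.
have sum_odd : odd n -> form_sum L (r * n) r 1 (r * n)
    = (-1) ^+ (odd r && two_nonresidue n) * 2 ^+ (r * (n + 1) %/ 2).
  move=> on; rewrite (form_sum_odd hL erefl on (dvdnn n)); congr (_ * _ ^+ _).
  by rewrite -muln_divA ?divn2 ?addn1 // dvdn2 /= on.
have sum_4 : (n %% 4 = 0)%N -> form_sum L (r * n) r 1 (r * n)
    = - (-1) ^+ (odd r && odd (n %/ 4)) * 2 ^+ (r * (n + 2) %/ 2).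
  move=> n4; rewrite (form_sum_0mod4 hL erefl n4); congr (_ * _ ^+ _).
  by rewrite -muln_divA ?divn2 // dvdn2; lia.
split=> [or|/negPf er].
  split=> n8.
  - rewrite sum_odd ?or /two_nonresidue; last by lia.
    by case: n8 => ->; rewrite mul1r.
  - rewrite sum_odd ?or /two_nonresidue; last by lia.
    by case: n8 => ->; rewrite mulN1r.
  - by rewrite (form_sum_2mod4 hL erefl) ?addr0 //; lia.
  - rewrite sum_4 ?or; last by lia.
    by rewrite (_ : odd (n %/ 4)) ?opprK ?mul1r //; lia.
  - rewrite sum_4 ?or; last by lia.
    by rewrite (_ : odd (n %/ 4) = false) ?mulN1r //; lia.
split=> n4.
- by rewrite sum_odd ?er ?mul1r //; lia.
- by rewrite (form_sum_2mod4 hL erefl) ?addr0.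
- by rewrite sum_4 // er mulN1r.
Qed.
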